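(* Let $G$ be a simple graph of order $n>2$ that is not isomorphic to $K_{1,n-r-1}\cup rK_1$ for any $r$ with $0\le r\le\lceil n/2\rceil-2$ or $r=n-2$. Then $\sigma(G)\ge 2$.
   Context: For a graph $G$ with $n$ vertices and $m$ edges, let $\mu_1\ge\cdots\ge\mu_n=0$ be the eigenvalues of the Laplacian matrix $L(G)=D(G)-A(G)$. $\sigma(G)$ is the largest integer $\sigma$ with $1\le\sigma\le n$ such that $\mu_\sigma\ge\frac{2m}{n}$. $K_{1,p}$ is the star with $p$ leaves, $rK_1$ is $r$ isolated vertices, $\cup$ is disjoint union. *)

(* Defs.v *)
From HB Require Import structures.
From mathcomp Require Import all_boot all_order all_algebra.
From mathcomp Require Import polyrcf.

Set Implicit Arguments.
Unset Strict Implicit.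
Unset Printing Implicit Defensive.

Import Order.TTheory GRing.Theory Num.Theory.
Local Open Scope ring_scope.

Record sgraph := SGraph {
  vertex :> finType;
  adj : rel vertex;
  adj_sym : symmetric adj;
  adj_irrefl : irreflexive adj }.

Definition edges (G : sgraph) : {set {set G}} :=
  [set [set p.1; p.2] | p : G * G & adj p.1 p.2].

Definition degree (G : sgraph) (v : G) : nat := #|[set w | adj v w]|.

Definition isomorphic (G H : sgraph) : Prop :=
  exists2 f : G -> H, bijective f & forall x y, adj (f x) (f y) = adj x y.

(* K_{1,p}: the center is None, the leaves are the Some i. *)
Section Star.
Variable p : nat.
Definition star_adj (x y : option 'I_p) : bool := isSome x (+) isSome y.
Lemma star_sym : symmetric star_adj. Proof. by move=> x y; exact: addbC. Qed.
Lemma star_irrefl : irreflexive star_adj. Proof. by move=> x; exact: addbb. Qed.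
Definition star := SGraph star_sym star_irrefl.
End Star.

Section Edgeless.
Variable r : nat.
Definition edgeless_adj (x y : 'I_r) : bool := false.
Lemma edgeless_sym : symmetric edgeless_adj. Proof. by []. Qed.
Lemma edgeless_irrefl : irreflexive edgeless_adj. Proof. by []. Qed.
Definition edgeless := SGraph edgeless_sym edgeless_irrefl.
End Edgeless.

Section DisjointUnion.
Variables G H : sgraph.
Definition dunion_adj (x y : G + H) : bool :=
  match x, y with
  | inl u, inl v => adj u v
  | inr u, inr v => adj u v
  | _, _ => false
  end.
Lemma dunion_sym : symmetric dunion_adj.
Proof. by move=> [u|u] [v|v] //=; exact: adj_sym. Qed.
Lemma dunion_irrefl : irreflexive dunion_adj.
Proof. by move=> [u|u] /=; exact: adj_irrefl. Qed.
Definition dunion := SGraph dunion_sym dunion_irrefl.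
End DisjointUnion.

(* Matrices of G are indexed by 'I_#|G| through the enumeration of vertices. *)
Definition degree_mx (R : rcfType) (G : sgraph) : 'M[R]_#|G| :=
  diag_mx (\row_i (degree (enum_val i : G))%:R).

Definition adj_mx (R : rcfType) (G : sgraph) : 'M[R]_#|G| :=
  \matrix_(i, j) (adj (enum_val i : G) (enum_val j))%:R.

Definition laplacian (R : rcfType) (G : sgraph) : 'M[R]_#|G| :=
  degree_mx R G - adj_mx R G.

(* The roots in R of the characteristic polynomial, each repeated according to
   its multiplicity, in nonincreasing order. *)
Definition eigenvalues (R : rcfType) n (A : 'M[R]_n) : seq R :=
  sort >=%R (flatten [seq nseq (mup x (char_poly A)) x
                     | x <- rootsR (char_poly A)]).

(* mu_k, with k counted from 1; the default 0 is not reached for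
   1 <= k <= #|G|, since a symmetric matrix has all its eigenvalues in R. *)
Definition mu (R : rcfType) (G : sgraph) (k : nat) : R :=
  nth 0 (eigenvalues (laplacian R G)) k.-1.

Definition sigma (R : rcfType) (G : sgraph) : nat :=
  (\max_(1 <= k < #|G|.+1 |
      ((2 * #|edges G|)%N%:R / #|G|%:R <= mu R G k)%R) k)%N.

(* Main.v *)
Require Import Defs.
From mathcomp Require Import all_boot all_order all_algebra.
From mathcomp Require Import complex polyrcf.
From mathcomp Require Import ring lra zify.

(* Write t = 2m/n, L for the Laplacian, and let u be a vertex of maximal degree,
   so d(u) >= t.  By the spectral theorem mu_2 >= t as soon as the form L - t is
   positive semidefinite on some plane.  Two planes suffice: the one spanned by
   e_u and e_w, for w not adjacent to u and d(w) >= t, and the one spanned by e_u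
   and e_i - e_j, for an edge ij avoiding u with
     ([u ~ i] - [u ~ j])^2 <= (d(u) - t) (d(i) + d(j) + 2 - 2t).
   If d(u) >= t + 1, averaging d(i) + d(j) over all edges ij avoiding u yields
   such an edge.  If d(u) < t + 1, the average degree forces G to be almost
   regular, and an edge is found directly.  If no edge avoids u, then G is a star
   plus isolated vertices, and the non-exceptional ones have two nonadjacent
   leaves and t <= 1 (or no edge at all). *)

Set Implicit Arguments.
Unset Strict Implicit.
Unset Printing Implicit Defensive.

Import Order.TTheory GRing.Theory Num.Theory.
Local Open Scope ring_scope.
Local Open Scope sesquilinear_scope.

(** * Spectra of real symmetric matrices and a plane criterion for the second eigenvalue *)

Lemma char_poly_conj (F : fieldType) n (P A : 'M[F]_n) :
  P \in unitmx -> char_poly (invmx P *m A *m P) = char_poly A.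
Proof.
move=> Pu; rewrite /char_poly /char_poly_mx.
have -> : 'X%:M - map_mx polyC (invmx P *m A *m P)
   = map_mx polyC (invmx P) *m ('X%:M - map_mx polyC A) *m map_mx polyC P.
  rewrite mulmxBr mulmxBl !map_mxM; congr (_ - _).
  by rewrite mul_mx_scalar -scalemxAl -map_mxM mulVmx // map_mx1 scalemx1.
rewrite !det_mulmx mulrAC -det_mulmx -map_mxM mulVmx //.
by rewrite map_mx1 det1 mul1r.
Qed.

Section Spectrum.
Variable R : rcfType.
Local Notation toC := (real_complex R).

(** A real symmetric matrix is Hermitian over [R[i]], so it is unitarily diagonalizable with real
    spectrum; taking real parts brings the diagonal back to [R]. *)
Lemma symmetric_spectral n (A : 'M[R]_n) : A^T = A ->
  exists P : 'M[R[i]]_n, exists2 r : 'rV[R]_n, P \is unitarymx &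
    map_mx toC A = invmx P *m diag_mx (map_mx toC r) *m P.
Proof.
move=> symA; pose AC : 'M[R[i]]_n := map_mx toC A.
have hermA : AC \is hermsymmx.
  apply: realsym_hermsym.
    by apply/is_hermitianmxP; rewrite expr0 scale1r map_mx_id // /AC map_trmx symA.
  by apply/mxOverP => i j; rewrite mxE; apply/complex_realP; exists (A i j).
have /mxOverP realD := hermitian_spectral_diag_real hermA.
have /hermitian_normalmx/orthomx_spectralP eqA := hermA.
exists (spectralmx AC), (map_mx (@complex.Re R) (spectral_diag AC)).
  exact: spectral_unitarymx.
suff -> : map_mx toC (map_mx (@complex.Re R) (spectral_diag AC)) = spectral_diag AC by [].
by apply/rowP => i; rewrite !mxE RRe_real.
Qed.

(** Both lists contain each [x] exactly [mup x (char_poly A)] times: only the block of [x] itself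
    contributes to the count in the flattened list. *)
Lemma perm_eigenvalues n (A : 'M[R]_n) (r : 'rV[R]_n) :
  char_poly A = \prod_(i < n) ('X - (r 0 i)%:P) ->
  perm_eq (eigenvalues A) [seq r 0 i | i <- enum 'I_n].
Proof.
move=> chA; rewrite /eigenvalues perm_sort; apply/allP => x _ /=; apply/eqP.
have pn0 : char_poly A != 0 by rewrite monic_neq0 // char_poly_monic.
have -> : count_mem x [seq r 0 i | i <- enum 'I_n] = mup x (char_poly A).
  by rewrite -mu_prod_XsubC big_map big_enum chA.
have uq : uniq (rootsR (char_poly A)) by exact: uniq_roots.
rewrite count_flatten -map_comp sumnE big_map.
under eq_bigr => y _ do rewrite /= count_nseq /=.
rewrite (bigID (pred1 x)) /= [X in (_ + X)%N]big1 ?addn0 => [|y /negPf->]; last first.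
  by rewrite mul0n.
have xR := roots_on_rootsR pn0 x; rewrite inE /= in xR.
have [rx|nrx] := boolP (root (char_poly A) x).
  by rewrite -big_filter filter_pred1_uniq -?xR // big_seq1 eqxx mul1n.
rewrite mupNroot // big1_seq // => y /andP[/eqP -> yR].
by rewrite -xR (negPf nrx) in yR.
Qed.

Lemma sorted_ge_nth1 (s : seq R) t :
  sorted >=%R s -> (1 < count (>= t) s)%N -> t <= nth 0 s 1.
Proof.
case: s => [|a [|b s]] //=; first by case: (_ <= _).
case/andP => _ pb; case: (leP t b) => // ltb.
suff -> : count (>= t) s = 0%N by case: (_ <= _).
apply/eqP; rewrite -leqn0 leqNgt -has_count; apply/hasPn => z zs /=.
have /allP/(_ z zs) /= := order_path_min (rev_trans le_trans) pb.
by rewrite -ltNge => /le_lt_trans; apply.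
Qed.

(** For unitary [P], [invmx P] is the conjugate transpose, so the form is diagonal in the
    coordinates [z *m invmx P]. *)
Lemma diag_form n (P : 'M[R[i]]_n) (r : 'rV[R]_n) (z : 'rV[R[i]]_n) :
  P \is unitarymx ->
  (z *m (invmx P *m diag_mx (map_mx toC r) *m P) *m z ^t*) 0 0
  = \sum_i toC (r 0 i) * `|(z *m invmx P) 0 i| ^+ 2.
Proof.
move=> Pu; set w := z *m invmx P.
have -> : z *m (invmx P *m diag_mx (map_mx toC r) *m P) *m z ^t* =
  w *m diag_mx (map_mx toC r) *m w ^t*.
  rewrite /w invmx_unitary // trmx_mul map_mxM map_trmx trmxK -map_mx_comp.
  by rewrite (map_mx_id (@conjCK _)) !mulmxA.
rewrite mxE; apply: eq_bigr => i _.
by rewrite mul_mx_diag !mxE normCK mulrCA mulrA.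
Qed.

(* For [al > 0], [al] times the form is
   [|c al + d be|^2 + (al ga - be^2) |d|^2]. *)
Lemma hermitian_form2_ge0 (C : numClosedFieldType) (c d al be ga : C) :
  al \is Num.real -> be \is Num.real -> ga \is Num.real ->
  0 <= al -> 0 <= ga -> be ^+ 2 <= al * ga ->
  0 <= c * c^* * al + c * d^* * be + d * c^* * be + d * d^* * ga.
Proof.
move=> alR beR gaR al0 ga0 beag.
have [al00|aln0] := eqVneq al 0.
  have -> : be = 0.
    apply/eqP; rewrite -sqrf_eq0 eq_le -realEsqr beR andbT.
    by move: beag; rewrite al00 mul0r.
  by rewrite al00 !mulr0 !add0r mulr_ge0 // mul_conjC_ge0.
have algt : 0 < al by rewrite lt_def aln0.
rewrite -(pmulr_rge0 _ algt).
have -> : al * (c * c^* * al + c * d^* * be + d * c^* * be + d * d^* * ga) =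
   (c * al + d * be) * (c * al + d * be)^* + (al * ga - be ^+ 2) * (d * d^*).
  rewrite rmorphD !rmorphM /= (CrealP alR) (CrealP beR); ring.
by rewrite addr_ge0 ?mul_conjC_ge0 // mulr_ge0 ?mul_conjC_ge0 // subr_ge0.
Qed.

(** A Courant-Fischer argument. The last three hypotheses say that the Gram matrix of [A - t] on
    [x], [y] is positive semidefinite. If at most one eigenvalue reached [t], some nonzero vector of
    the complex plane spanned by [x] and [y] would have no component along its eigenvector, and the
    form would be negative there. *)
Lemma le_eigenvalue2 n (A : 'M[R]_n) (t : R) (x y : 'rV[R]_n) :
  let q u v := (u *m (A - t%:M) *m v^T) 0 0 in
  A^T = A -> row_free (col_mx x y) ->
  0 <= q x x -> 0 <= q y y -> q x y ^+ 2 <= q x x * q y y ->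
  t <= nth 0 (eigenvalues A) 1.
Proof.
move=> q symA xyfree qx qy qxy.
have [P [r Pu eqA]] := symmetric_spectral symA.
have Pun := unitarymx_unit Pu.
have chA : char_poly A = \prod_(i < n) ('X - (r 0 i)%:P).
  (* The factorization is checked after the injective embedding into [R[i]], where [A] is similar to
     a diagonal matrix. *)
  apply: (map_poly_inj toC).
  rewrite map_char_poly eqA char_poly_conj // char_poly_trig ?diag_mx_is_trig //.
  rewrite rmorph_prod; apply: eq_bigr => i _ /=.
  by rewrite rmorphB /= map_polyX map_polyC !mxE eqxx.
apply: sorted_ge_nth1; first by apply: sort_sorted => a b; exact: ge_total.
rewrite (permP (perm_eigenvalues chA)) count_map -size_filter.
rewrite ltnNge; apply/negP => small.
have [i0 lti0] : exists i0 : 'I_n, forall i, i != i0 -> r 0 i < t.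
  have n_gt0 : (0 < n)%N.
    by apply: leq_trans (rank_leq_col (col_mx x y)); rewrite (eqP xyfree).
  (* The only index whose eigenvalue reaches [t]; if there is none, the default index serves equally
     well. *)
  exists (head (Ordinal n_gt0) [seq i <- enum 'I_n | t <= r 0 i]) => i.
  rewrite ltNge; apply: contra => ti.
  have : i \in [seq i <- enum 'I_n | t <= r 0 i] by rewrite mem_filter ti mem_enum.
  by case: filter small => [|j [|k l]] //= _; rewrite inE.
pose a := (map_mx toC y *m invmx P) 0 i0.
pose b := (map_mx toC x *m invmx P) 0 i0.
(* One linear equation in two unknowns: a nontrivial combination with vanishing [i0] coordinate. *)
have [[c d] /= cd0 cdab] : exists2 cd : R[i] * R[i],
    (cd.1 != 0) || (cd.2 != 0) & cd.1 * b + cd.2 * a = 0.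
  have [ab0|abn0] := boolP ((a == 0) && (b == 0)).
    by exists (1, 0); rewrite /= ?oner_eq0 //; case/andP: ab0 => /eqP-> /eqP->; ring.
  exists (a, - b) => /=; last by ring.
  by rewrite oppr_eq0 -negb_and.
pose z := c *: map_mx toC x + d *: map_mx toC y.
have z0 : z != 0.
  have -> : z = row_mx c%:M d%:M *m map_mx toC (col_mx x y).
    by rewrite map_col_mx mul_row_col !mul_scalar_mx.
  rewrite mulmx_free_eq0 ?row_free_map //; apply: contraTneq cd0.
  move/eqP; rewrite row_mx_eq0 => /andP[/eqP/matrixP/(_ 0 0)].
  rewrite !mxE mulr1n => -> /eqP/matrixP/(_ 0 0).
  by rewrite !mxE mulr1n => ->; rewrite eqxx.
have zi0 : (z *m invmx P) 0 i0 = 0.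
  by rewrite mulmxDl -!scalemxAl mxE [X in X + _]mxE [X in _ + X]mxE.
pose B := map_mx toC (A - t%:M).
have hE (u v : 'rV[R]_n) : (map_mx toC u *m B *m (map_mx toC v) ^t*) 0 0 = toC (q u v).
  have -> : (map_mx toC v) ^t* = map_mx toC (v^T).
    by apply/matrixP => i j; rewrite !mxE conj_Creal //; apply/complex_realP; exists (v j i).
  by rewrite -!map_mxM mxE.
have qC : q y x = q x y.
  have <- : ((x *m (A - t%:M) *m y^T)^T) 0 0 = q x y by rewrite mxE.
  by rewrite !trmx_mul trmxK linearB /= symA tr_scalar_mx mulmxA.
have realC (k : R) : toC k \is Num.real by apply/complex_realP; exists k.
have form_ge0 : 0 <= (z *m B *m z ^t*) 0 0.
  have -> : (z *m B *m z ^t*) 0 0 = c * c^* * toC (q x x) + c * d^* * toC (q x y)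
     + d * c^* * toC (q x y) + d * d^* * toC (q y y).
    rewrite -[in d * c^* * _]qC -!hE /z linearD /= map_mxD !linearZ /= !map_mxZ.
    rewrite !mulmxDl !mulmxDr -!scalemxAl -!scalemxAr.
    by rewrite !mxE /=; ring.
  by apply: hermitian_form2_ge0; rewrite ?realC ?ler0c // -rmorphXn -rmorphM lecR.
have eqB : B = invmx P *m diag_mx (map_mx toC (r - const_mx t)) *m P.
  rewrite /B map_mxB map_scalar_mx eqA map_mxB map_const_mx linearB /=.
  by rewrite diag_const_mx mulmxBr mulmxBl mul_mx_scalar -scalemxAl mulVmx // scalemx1.
(* Some coordinate [j] other than [i0] is nonzero; its term is strictly negative and no other term
   is positive. *)
have [j wj0] : exists j, (z *m invmx P) 0 j != 0.
  apply/rV0Pn; apply: contraNneq z0 => w0.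
  by rewrite -[z](mulmxKV Pun) w0 mul0mx.
have jNi0 : j != i0 by apply: contraNneq wj0 => ->; rewrite zi0.
move: form_ge0; rewrite eqB diag_form // (bigD1 j) //=; apply/negP.
rewrite -real_ltNge ?rpred0 //; last first.
  by rewrite rpredD ?rpred_sum // => [|i _]; rewrite rpredM ?realC ?rpredX ?normr_real.
rewrite ltr_wnDr ?sumr_le0 //= => [i _|].
  have [->|iNi0] := eqVneq i i0; first by rewrite zi0 normr0 expr0n mulr0.
  by rewrite mulr_le0_ge0 ?exprn_ge0 // lecR !mxE subr_le0 ltW // lti0.
by rewrite nmulr_rlt0 ?exprn_gt0 ?normr_gt0 // ltcR !mxE subr_lt0 lti0.
Qed.
End Spectrum.

Lemma row_free_col_mx2 (F : fieldType) n (x y : 'rV[F]_n) (k : 'I_n) :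
  x 0 k != 0 -> y 0 k = 0 -> y != 0 -> row_free (col_mx x y).
Proof.
move=> xk yk y0; rewrite -kermx_eq0; apply/rowV0P => v /sub_kermxP.
rewrite -[v]hsubmxK mul_row_col [lsubmx v]mx11_scalar [rsubmx v]mx11_scalar.
rewrite !mul_scalar_mx; set a := lsubmx v 0 0; set b := rsubmx v 0 0 => xy0.
have a0 : a = 0.
  move/rowP/(_ k)/eqP: xy0; rewrite !mxE yk mulr0 addr0 mulf_eq0 (negPf xk) orbF.
  by move/eqP.
move/eqP: xy0; rewrite a0 scale0r add0r scaler_eq0 (negPf y0) orbF => /eqP ->.
by rewrite !raddf0 row_mx0.
Qed.

(** The ordered ring may be non-archimedean, so the integer part is found by descending from the
    bound [m]. *)
Lemma nat_floor (R : realDomainType) (x : R) (m : nat) : 0 <= x -> x < m%:R ->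
  exists2 k : nat, k%:R <= x & x < k.+1%:R.
Proof.
move=> x0; elim: m => [|m IHm]; first by rewrite ltNge x0.
by move=> xm; case: (leP m%:R x) => [mx|/IHm //]; exists m.
Qed.

(** * Degrees, the handshake identity, and recognition of stars with isolated vertices *)

Section Graph.
Variable G : sgraph.
Implicit Types u v w i j : G.

Lemma degreeE v : degree v = (\sum_w adj v w)%N.
Proof. by rewrite /degree -sum1dep_card big_mkcond /=; apply: eq_bigr => w _; case: adj. Qed.

Lemma adj_neq v w : adj v w -> v != w.
Proof. by apply: contraTneq => ->; rewrite adj_irrefl. Qed.

Lemma degree_lt v : (degree v < #|G|)%N.
Proof.
rewrite /degree -cardsT; apply: proper_card; rewrite properT.
by apply: contraFneq (adj_irrefl v) => eqT; have := in_setT v; rewrite -eqT inE.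
Qed.

Lemma degree_full u w : degree u = #|G|.-1 -> w != u -> adj u w.
Proof.
move=> du wu; suff /setP/(_ w) : [set w | adj u w] = ~: [set u] by rewrite !inE wu.
apply/eqP; rewrite eqEcard cardsC1 -du leqnn andbT.
by apply/subsetP => z; rewrite !inE eq_sym; exact: adj_neq.
Qed.

Lemma degree_gt0 v w : adj v w -> (0 < degree v)%N.
Proof. by move=> vw; apply/card_gt0P; exists w; rewrite inE. Qed.

(** Both sides count the ordered adjacent pairs: each edge is the image of exactly two of them under
    [h]. *)
Lemma handshake : (\sum_(v : G) degree v = 2 * #|edges G|)%N.
Proof.
pose D := [set p : G * G | adj p.1 p.2].
have -> : (\sum_(v : G) degree v = \sum_(p in D) 1)%N.
  rewrite (eq_bigl (fun p => true && adj p.1 p.2)) => [|p]; last by rewrite inE.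
  rewrite -(pair_big_dep xpredT (fun v w => adj v w) (fun _ _ => 1%N)) /=.
  by apply: eq_bigr => v _; rewrite sum1dep_card.
pose h (p : G * G) : {set G} := [set p.1; p.2].
have eqE : edges G = h @: D.
  by apply/setP => e; apply/imsetP/imsetP => -[p]; rewrite inE => ap ->; exists p; rewrite ?inE.
rewrite (partition_big h (mem (edges G))) /= => [|p pD]; last by rewrite eqE imset_f.
rewrite mulnC -sum_nat_const; apply: eq_bigr => e.
rewrite eqE => /imsetP[[v w]]; rewrite inE /= => vw ->.
rewrite sum1dep_card.
have -> : [set p in D | h p == h (v, w)] = [set (v, w); (w, v)].
  apply/setP => -[x y]; rewrite !inE /h /= !xpair_eqE.
  apply/andP/orP => [[xy /eqP/setP eqxy]|[] /andP[/eqP-> /eqP->]]; last 2 first.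
  - by rewrite vw eqxx.
  - by rewrite adj_sym vw setUC eqxx.
  have := eqxy x; have := eqxy y; rewrite !inE !eqxx orbT /=.
  case: (eqVneq y v) => [yv|_] /=.
    by case: (eqVneq x v) => [xv|_] /= _ => [|/esym ->]; [rewrite xv yv adj_irrefl in xy | right].
  move=> /esym/eqP yw; rewrite yw eqxx; case: (eqVneq x v) => [|_] /=; first by left.
  by move=> /esym/eqP xw; rewrite xw yw adj_irrefl in xy.
by rewrite cards2 xpair_eqE (negPf (adj_neq vw)).
Qed.

Lemma card_nonneighbors u :
  #|[set w | (w != u) && ~~ adj u w]| = (#|G| - 1 - degree u)%N.
Proof.
have -> : [set w | (w != u) && ~~ adj u w] = (~: [set w | adj u w]) :\ u.
  by apply/setP => w; rewrite !inE.
have := cardsC [set w | adj u w]; have := cardsD1 u (~: [set w | adj u w]).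
by rewrite !inE adj_irrefl /degree; lia.
Qed.

(** Every edge meets [u], so [u] is the center, its neighbors are the leaves and the other vertices
    are isolated. The map [g] goes from the model to [G]; injectivity and equal cardinalities make
    it invertible, and its inverse is the isomorphism. *)
Lemma star_iso u : (forall i j, i != u -> j != u -> ~~ adj i j) ->
  isomorphic G (dunion (star (degree u)) (edgeless (#|G| - 1 - degree u))).
Proof.
rewrite -card_nonneighbors -[degree u]/#|[set w | adj u w]|.
set N := [set w | adj u w]; set Q := [set w | _ && _] => noedge.
pose g (z : dunion (star #|N|) (edgeless #|Q|)) : G :=
  match z with
  | inl None => u
  | inl (Some i) => enum_val i
  | inr i => enum_val i
  end.
have NP (i : 'I_#|N|) : adj u (enum_val i) by have := enum_valP i; rewrite inE.
have QP (i : 'I_#|Q|) : (enum_val i != u) && ~~ adj u (enum_val i).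
  by have := enum_valP i; rewrite inE.
have g_inj : injective g.
  move=> [[i|]|i] [[j|]|j] //=.
  - by move/enum_val_inj ->.
  - by move=> eqg; have := NP i; rewrite eqg adj_irrefl.
  - by move=> eqg; have := NP i; rewrite eqg; have /andP[_ /negPf->] := QP j.
  - by move=> eqg; have := NP j; rewrite -eqg adj_irrefl.
  - by move=> eqg; have := QP j; rewrite -eqg eqxx.
  - by move=> eqg; have := NP j; rewrite -eqg; have /andP[_ /negPf->] := QP i.
  - by move=> eqg; have := QP i; rewrite eqg eqxx.
  - by move/enum_val_inj ->.
have g_adj x y : adj (g x) (g y) = adj x y.
  have NQ (v w : G) : v != u -> w != u -> adj v w = false.
    by move=> vu wu; apply: negbTE; exact: noedge.
  have Nu (i : 'I_#|N|) : enum_val i != u by rewrite eq_sym adj_neq.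
  have Qu (i : 'I_#|Q|) : enum_val i != u by case/andP: (QP i).
  have Qn (i : 'I_#|Q|) : adj u (enum_val i) = false by case/andP: (QP i) => _ /negPf.
  case: x => [[i|]|i]; case: y => [[j|]|j] /=.
  - by rewrite NQ.
  - by rewrite adj_sym NP.
  - by rewrite NQ.
  - by rewrite NP.
  - by rewrite adj_irrefl.
  - by rewrite Qn.
  - by rewrite NQ.
  - by rewrite adj_sym Qn.
  - by rewrite NQ.
have [|f gK fK] := inj_card_bij g_inj.
  have -> : #|dunion (star #|N|) (edgeless #|Q|)| = (#|N|.+1 + #|Q|)%N.
    by rewrite -[LHS]/#|{: option 'I_#|N| + 'I_#|Q|}| card_sum card_option !card_ord.
  have := card_nonneighbors u; have := degree_lt u.
  by rewrite -/N -/Q -[degree u]/#|N|; lia.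
exists f; first by exists g.
by move=> x y; rewrite -g_adj !fK.
Qed.
End Graph.

(** * The shifted Laplacian form on explicit planes *)

Section LaplacianForm.
Variables (R : rcfType) (G : sgraph).
Implicit Types u v w i j : G.
Local Notation d v := ((degree v)%:R : R).
Local Notation a v w := ((adj v w)%:R : R).
Local Notation avg := ((2 * #|edges G|)%N%:R / #|G|%:R : R).

Lemma laplacianE u v :
  laplacian R G (enum_rank u) (enum_rank v) = d u *+ (u == v) - a u v.
Proof. by rewrite !mxE !enum_rankK (inj_eq enum_rank_inj). Qed.

Lemma laplacian_sym : (laplacian R G)^T = laplacian R G.
Proof.
apply/matrixP => i j; rewrite !mxE adj_sym eq_sym.
by case: eqVneq => [->|].
Qed.

Lemma sum_degree : (0 < #|G|)%N -> \sum_(v : G) d v = avg * #|G|%:R.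
Proof.
by move=> n0; rewrite -natr_sum handshake divfK // pnatr_eq0 -lt0n.
Qed.

Lemma sigma_ge2 : (1 < #|G|)%N -> avg <= mu R G 2 -> (2 <= sigma R G)%N.
Proof.
move=> n2 t2; rewrite /sigma.
by apply: (@leq_bigmax_seq _ _ _ (fun k => k) 2%N); rewrite // mem_index_iota.
Qed.

Let e u : 'rV[R]_#|G| := delta_mx 0 (enum_rank u).

Let form_e t u v : (e u *m (laplacian R G - t%:M) *m (e v)^T) 0 0
  = (d u - t) *+ (u == v) - a u v.
Proof.
rewrite trmx_delta -rowE -colE mxE mxE mxE laplacianE 2!mxE (inj_eq enum_rank_inj).
by rewrite mulrnBl; ring.
Qed.

Let formBl t (x y z : 'rV[R]_#|G|) :
  ((x - y) *m (laplacian R G - t%:M) *m z^T) 0 0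
  = (x *m (laplacian R G - t%:M) *m z^T) 0 0 - (y *m (laplacian R G - t%:M) *m z^T) 0 0.
Proof. by rewrite !mulmxBl mxE [X in _ + X]mxE. Qed.

Let formBr t (x y z : 'rV[R]_#|G|) :
  (z *m (laplacian R G - t%:M) *m (x - y)^T) 0 0
  = (z *m (laplacian R G - t%:M) *m x^T) 0 0 - (z *m (laplacian R G - t%:M) *m y^T) 0 0.
Proof. by rewrite [(x - y)^T]linearB /= mulmxBr mxE [X in _ + X]mxE. Qed.

Let e_at u v : e u 0 (enum_rank v) = (v == u)%:R.
Proof. by rewrite mxE (inj_eq enum_rank_inj). Qed.

(** On [e u], [e w] the Gram matrix is diagonal, with entries [d u - t] and [d w - t]. *)
Lemma mu2_nonadjacent u w t : u != w -> ~~ adj u w -> t <= d u -> t <= d w ->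
  t <= mu R G 2.
Proof.
move=> uw nuw tu tw; apply: (le_eigenvalue2 (x := e u) (y := e w)).
- exact: laplacian_sym.
- apply: (@row_free_col_mx2 _ _ _ _ (enum_rank u)).
  + by rewrite e_at eqxx oner_eq0.
  + by rewrite e_at (negPf uw).
  + by apply/rV0Pn; exists (enum_rank w); rewrite e_at eqxx oner_eq0.
- by rewrite form_e eqxx adj_irrefl subr0 subr_ge0.
- by rewrite form_e eqxx adj_irrefl subr0 subr_ge0.
- rewrite !form_e !eqxx (negPf uw) (negPf nuw) !adj_irrefl /= !mulr1n !subr0 expr0n /=.
  by rewrite mulr_ge0 ?subr_ge0.
Qed.

(** On [e u], [e i - e j] the diagonal entries are [d u - t] and [d i + d j + 2 - 2 * t], and the
    off-diagonal one is [a u j - a u i]; the last hypothesis is nonnegativity of the determinant. *)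
Lemma mu2_edge u i j t : i != u -> j != u -> adj i j -> t <= d u ->
  2 * t <= d i + d j + 2 ->
  (a u i - a u j) ^+ 2 <= (d u - t) * (d i + d j + 2 - 2 * t) ->
  t <= mu R G 2.
Proof.
move=> iu ju ij tu tij cond.
have form_ij : ((e i - e j) *m (laplacian R G - t%:M) *m (e i - e j)^T) 0 0
    = d i + d j + 2 - 2 * t.
  rewrite formBl !formBr !form_e !eqxx !adj_irrefl (eq_sym j) (negPf (adj_neq ij)).
  by rewrite (adj_sym j) ij /= !mulr1n !mulr0n; ring.
apply: (le_eigenvalue2 (x := e u) (y := e i - e j)).
- exact: laplacian_sym.
- apply: (@row_free_col_mx2 _ _ _ _ (enum_rank u)).
  + by rewrite e_at eqxx oner_eq0.
  + by rewrite mxE e_at mxE e_at !(eq_sym u) (negPf iu) (negPf ju) subrr.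
  + apply/rV0Pn; exists (enum_rank i); rewrite mxE e_at mxE e_at eqxx.
    by rewrite (negPf (adj_neq ij)) subr0 oner_eq0.
- by rewrite form_e eqxx adj_irrefl subr0 subr_ge0.
- by rewrite form_ij; lra.
- rewrite form_e form_ij formBr !form_e eqxx adj_irrefl.
  rewrite !(eq_sym u) (negPf iu) (negPf ju) subr0 /= !mulr0n mulr1n.
  by apply: le_trans cond; rewrite le_eqVlt; apply/orP; left; apply/eqP; ring.
Qed.

(** * Finding a suitable edge off [u], with [t] the average degree *)

Section OffVertex.
Variables (t : R) (u : G).
Hypothesis sum_d : \sum_(v : G) d v = t * #|G|%:R.

(** The bound makes [(d u - t) * (d i + d j + 2 - 2 * t)] at least 1, which suffices for [mu2_edge]
    because the squared difference of adjacencies is at most 1. *)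
Lemma heavy_edge i0 j0 : i0 != u -> j0 != u -> adj i0 j0 -> 1 <= d u - t ->
  exists i j, [/\ i != u, j != u, adj i j & 2 * t + (d u - t)^-1 <= d i + d j + 2].
Proof.
set Y := d u - t => i0u j0u ij0 Y1.
have YE : d u = t + Y by rewrite /Y; ring.
clearbody Y; pose tau := t + Y^-1 / 2.
have Y0 : 0 < Y by lra.
have Yi1 : Y^-1 <= 1 by rewrite invf_le1.
have Yi0 : 0 < Y^-1 by rewrite invr_gt0.
have tauE : 2 * t + Y^-1 = 2 * tau by rewrite /tau; field; rewrite gt_eqF.
have di0 : (1 : R) <= d i0 by rewrite ler1n (degree_gt0 ij0).
have dj0 : (1 : R) <= d j0 by rewrite ler1n (@degree_gt0 _ _ i0) // adj_sym.
(* For [tau <= 2] the given edge works, both its ends having degree at least 1. *)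
have [tau2|tau2] := leP tau 2.
  by exists i0, j0; split=> //; rewrite tauE; lra.
(* The degree threshold for the sign of [x i] below: nonpositive if [degree i < k], positive
   otherwise. *)
have [k ktau tauk] : exists2 k : nat, k%:R <= tau & tau < k.+1%:R.
  by apply: (@nat_floor _ _ (degree u).+1); rewrite -?natr1 /tau; lra.
rewrite -natr1 in tauk.
have k1 : (1 : R) <= k%:R.
  by rewrite ler1n lt0n; apply: contraTneq tauk => ->; rewrite -leNgt; lra.
(* The sum of [d i + d j + 2 - 2 * tau] over the ordered edges avoiding [u] is
   nonnegative: for integers [d i], [(d i - a u i - (k - 1)) * x i >= 0], so the
   vertex contributions [(d i - a u i) * x i] can be bounded below linearly. *)
pose c v : R := (v != u)%:R.
pose w i j : R := c i * c j * a i j.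
pose x i : R := d i + 1 - tau.
have w_sum i : \sum_j w i j = c i * (d i - a u i).
  rewrite /w degreeE natr_sum (bigD1 u) //= [in RHS](bigD1 u) //= (adj_sym i).
  rewrite /c eqxx mulr0 mul0r add0r addrAC subrr add0r mulr_sumr.
  by apply: eq_bigr => j ->; rewrite mulr1.
have sum_w : \sum_i \sum_j w i j * (x i + x j) = 2 * \sum_i c i * (d i - a u i) * x i.
  under eq_bigr => i _ do (under eq_bigr => j _ do rewrite mulrDr; rewrite big_split /=).
  rewrite big_split /= [X in _ + X]exchange_big /=.
  have -> : \sum_j \sum_i w i j * x j = \sum_i \sum_j w i j * x i.
    apply: eq_bigr => i _; apply: eq_bigr => j _.
    by rewrite /w (adj_sym j) [c j * _]mulrC.
  have -> : \sum_i \sum_j w i j * x i = \sum_i c i * (d i - a u i) * x i.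
    by apply: eq_bigr => i _; rewrite -mulr_suml w_sum.
  by ring.
have x_sum : 0 <= \sum_i c i * x i.
  have -> : \sum_i c i * x i = t * #|G|%:R - d u + (#|G|%:R - 1) * (1 - tau).
    have eqc (F : G -> R) : \sum_i c i * F i = \sum_i F i - F u.
      rewrite (bigD1 u) //= [in RHS](bigD1 u) //= /c eqxx mul0r add0r addrAC subrr add0r.
      by apply: eq_bigr => i ->; rewrite mul1r.
    rewrite eqc /x big_split big_split /= sum_d sumr_const sumr_const -[_ *+ _]mulr_natl.
    by rewrite -[(- tau) *+ _]mulr_natl; ring.
  have Dn : d u + 1 <= #|G|%:R by rewrite natr1 ler_nat degree_lt.
  rewrite -(pmulr_rge0 _ Y0).
  have -> : Y * (t * #|G|%:R - d u + (#|G|%:R - 1) * (1 - tau))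
    = Y * (#|G|%:R - 1 - Y) - (#|G|%:R - 1) / 2.
    by rewrite YE /tau; field; rewrite gt_eqF.
  (* Write [N] for [#|G| - 1]. From [tau > 2] and [Y >= 1] follows [t > 3/2], so [1 <= Y < N - 3/2].
     The expression [Y * (N - Y) - N / 2] is concave in [Y] and nonnegative at both ends of this
     range. *)
  move: tau2; rewrite /tau; nra.
have x_le i : (k%:R - 1) * (c i * x i) <= c i * (d i - a u i) * x i.
  rewrite /c; case: (i != u); rewrite ?mul0r ?mulr0 // !mul1r -subr_ge0 -mulrBl.
  rewrite /x; have [dk|] := ltnP (degree i) k.
    have : d i + 1 <= k%:R by rewrite natr1 ler_nat.
    by case: adj => /=; nra.
  by rewrite -(ler_nat R) => dk; case: adj => /=; nra.
have [/existsP[i /existsP[j /and4P[iu ju ij le_ij]]]|noedge] := boolP [exists i, exists j,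
    [&& i != u, j != u, adj i j & 2 * t + Y^-1 <= d i + d j + 2]].
  by exists i, j.
(* Without a heavy edge all terms of the weighted sum are nonpositive and that of [(i0, j0)] is
   negative, against the lower bound 0. *)
have lt_w i j : i != u -> j != u -> adj i j -> x i + x j < 0.
  move=> iu ju ij; rewrite ltNge; apply: contra noedge => xij.
  apply/existsP; exists i; apply/existsP; exists j; rewrite iu ju ij tauE /=.
  by move: xij; rewrite /x; lra.
have w_le i j : w i j * (x i + x j) <= 0.
  rewrite /w /c; case: (boolP (i != u)) => iu; last by rewrite !mul0r.
  case: (boolP (j != u)) => ju; last by rewrite mulr0 !mul0r.
  case: (boolP (adj i j)) => ij; last by rewrite mulr0 mul0r.
  by rewrite !mul1r ltW ?lt_w.
have : \sum_i \sum_j w i j * (x i + x j) < 0.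
  rewrite (bigD1 i0) //= (bigD1 j0) //= ltr_wnDr ?ltr_wnDr ?sumr_le0 // => [i _|].
    by rewrite sumr_le0.
  by rewrite /w /c i0u j0u ij0 !mul1r lt_w.
suff : 0 <= \sum_i \sum_j w i j * (x i + x j) by move=> /le_lt_trans/[apply]; rewrite ltxx.
rewrite sum_w mulr_ge0 ?ler0n //; apply: le_trans (ler_sum _ (fun i _ => x_le i)).
by rewrite -mulr_sumr mulr_ge0 // subr_ge0.
Qed.

(** The cases follow the vertices of maximal degree. A nonadjacent pair found among them gives
    [mu2_nonadjacent]; three pairwise adjacent ones give [mu2_edge] with zero left-hand side; with
    only one or two, the degree sum controls the remaining vertices. *)
Lemma mu2_near_regular i0 j0 : (2 < #|G|)%N -> i0 != u -> j0 != u -> adj i0 j0 ->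
  (forall v, (degree v <= degree u)%N) -> 0 <= d u - t -> d u - t < 1 ->
  t <= mu R G 2.
Proof.
set Y := d u - t => n3 i0u j0u ij0 umax Y0 Y1.
have YE : t = d u - Y by rewrite /Y; ring.
have [nonadj|/exists_inPn clique] := boolP [exists v in [pred v | degree v == degree u],
  (v != u) && ~~ adj u v].
  have /exists_inP[v /eqP dv /andP[vu uv]] := nonadj.
  by apply: (@mu2_nonadjacent u v); rewrite // 1?eq_sym // ?dv; lra.
(* [f v] is an integer, equal to 1 when [d v = d u] and at most 0 otherwise.  At
   most two vertices have degree [d u], so a positive sum forces [f] to vanish at
   nearly all others. *)
pose f v : R := d v - d u + 1.
have sum_f : \sum_v f v = #|G|%:R * (1 - Y).
  rewrite /f !big_split /= sum_d !sumr_const -[_ *+ _]mulr_natl -[1 *+ _]mulr_natl YE.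
  by ring.
have f_le0 v : degree v != degree u -> f v <= 0.
  move=> dvu; suff : d v + 1 <= d u by rewrite /f; lra.
  by rewrite natr1 ler_nat ltn_neqAle dvu umax.
(* When [#|G| = 3], [u] is adjacent to both [i] and [j], so the left-hand side of
   the criterion [mu2_edge] vanishes. *)
have edge_criterion i j : i != u -> j != u -> adj i j -> 2 * t <= d i + d j + 2 ->
  (#|G| = 3%N -> (1 < degree u)%N) ->
  ((3 < #|G|)%N -> 1 <= Y * (d i + d j + 2 - 2 * t)) -> t <= mu R G 2.
  move=> iu ju ij tij deg3 cond; apply: (mu2_edge iu ju ij) => //; first by lra.
  have [n4|n4] := ltnP 3 #|G|.
    by apply: le_trans (cond n4); case: adj; case: adj => /=; lra.
  have {n3 n4} n3 : #|G| = 3%N by apply/eqP; rewrite eqn_leq n3 n4.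
  have full : degree u = #|G|.-1.
    by apply/eqP; rewrite eqn_leq -ltnS prednK ?degree_lt n3 ?deg3.
  by rewrite !degree_full // subrr expr0n mulr_ge0 // subr_ge0.
have n3R : (3 < #|G|)%N -> (4 : R) <= #|G|%:R by rewrite (ler_nat R 4).
have f_int v : f v < 0 -> f v <= -1.
  rewrite /f => fv; have : d v + 1 < d u by lra.
  by rewrite natr1 ltr_nat -(ler_nat R) -2!natr1; lra.
have sum_pos : 0 < #|G|%:R * (1 - Y) by rewrite mulr_gt0 ?subr_gt0 // ltr0n (leq_trans _ n3).
have fu : f u = 1 by rewrite /f; ring.
have [/existsP[v /andP[vu /eqP dv]]|noother] :=
  boolP [exists v, (v != u) && (degree v == degree u)]; last first.
  have f_off v : v != u -> f v <= 0.
    move=> vu; apply: f_le0; apply: contra noother => dv.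
    by apply/existsP; exists v; rewrite vu.
  have sum_le v : v != u -> #|G|%:R * (1 - Y) <= 1 + f v.
    move=> vu; rewrite -sum_f (bigD1 u) //= (bigD1 v) //= addrA fu gerDl.
    by apply: sumr_le0 => i /andP[iu _]; exact: f_off.
  have d_off v : v != u -> d v = d u - 1.
    move=> vu; suff : f v = 0 by rewrite /f; lra.
    apply: le_anti; rewrite f_off //= leNgt; apply/negP => /f_int fv.
    by have := sum_le v vu; lra.
  (* All vertices but [u] now have degree [d u - 1]. For order at least 4 this bound gives
     [Y >= 3/4], so the determinant condition [2 * Y ^+ 2 >= 1] holds. *)
  have YN : #|G|%:R * (1 - Y) <= 1 by have := sum_le _ i0u; rewrite /f d_off //; lra.
  have di0 : (1 : R) <= d i0 by rewrite ler1n (degree_gt0 ij0).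
  have di0E := d_off _ i0u; have dj0E := d_off _ j0u.
  have sumE : d i0 + d j0 + 2 - 2 * t = 2 * Y by rewrite YE; lra.
  apply: (edge_criterion i0 j0 i0u j0u ij0) => [|_|/n3R n4].
  - by lra.
  - by rewrite -(ltr_nat R); lra.
  - by rewrite sumE; nra.
have uv : adj u v.
  by have := clique v; rewrite inE dv eqxx vu negbK => ->.
have [/existsP[w /and3P[wu wv /eqP dw]]|nothird] :=
  boolP [exists w, [&& w != u, w != v & degree w == degree u]].
  have uw : adj u w by have := clique w; rewrite inE dw eqxx wu negbK => ->.
  have [vw|nvw] := boolP (adj v w); last first.
    by apply: (@mu2_nonadjacent v w); rewrite // 1?eq_sym // ?dv ?dw; lra.
  apply: (mu2_edge vu wu vw); rewrite ?dv ?dw ?uv ?uw; try by lra.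
  by rewrite subrr expr0n mulr_ge0 //; lra.
have f_off w : w != u -> w != v -> f w <= 0.
  move=> wu wv; apply: f_le0; apply: contra nothird => dw.
  by apply/existsP; exists w; rewrite wu wv.
(* One end of the edge [i0 j0] is neither [u] nor [v]; its degree is positive and below [d u]. Hence
   [v], of degree [d u], has a neighbor besides [u]. *)
have deg2 : (1 < degree u)%N.
  have [i [iu iv i_pos]] : exists i, [/\ i != u, i != v & (0 < degree i)%N].
    have [eqi|i0v] := eqVneq i0 v; last by exists i0; rewrite i0v (degree_gt0 ij0).
    exists j0; split=> //; first by rewrite -eqi eq_sym adj_neq.
    by apply: (@degree_gt0 _ _ i0); rewrite adj_sym.
  have := f_off i iu iv; rewrite /f => fi.
  by have : d i + 1 <= d u; [lra | rewrite natr1 ler_nat => /(leq_trans _)->].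
have [w vw wu] : exists2 w, adj v w & w != u.
  have : (1 < #|[set w | adj v w]|)%N by rewrite -[#|_|]/(degree v) dv.
  case/card_gt1P => x [y [xv yv xy]]; rewrite !inE in xv yv.
  by have [xu|] := eqVneq x u; [exists y; rewrite // -xu eq_sym | exists x].
have wv : w != v by rewrite eq_sym adj_neq.
have sum_le : #|G|%:R * (1 - Y) <= 2 + f w.
  rewrite -sum_f (bigD1 u) //= (bigD1 v) //= (bigD1 w) /= ?wu // !addrA fu.
  have : \sum_(i | (i != u) && (i != v) && (i != w)) f i <= 0.
    by apply: sumr_le0 => i /andP[/andP[iu iv] _]; exact: f_off.
  by rewrite dv; lra.
have dwE : d w = d u - 1 + f w by rewrite /f; ring.
(* The sum of [f] is positive and at most [2 + f w], so the integer [f w] exceeds -2. *)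
have fw : f w = 0 \/ f w = -1.
  have [f0|f1] := leP 0 (f w); [left|right]; apply: le_anti.
    by rewrite f_off.
  rewrite f_int //= leNgt; apply/negP => f2.
  suff : f w <= -2 by lra.
  rewrite /f in f2 *; have : d w + 1 + 1 < d u by lra.
  by rewrite !natr1 ltr_nat -(ler_nat R) -3!natr1; lra.
have sumE : d v + d w + 2 - 2 * t = 2 * Y + 1 + f w by rewrite dv dwE YE; ring.
apply: (edge_criterion v w vu wu vw) => [|//|/n3R n4]; first by case: fw => fwE; lra.
(* With order at least 4, [f w = 0] gives [Y >= 1/2] and [Y * (2 * Y + 1) >= 1]; [f w = -1] gives
   [Y >= 3/4] and [2 * Y ^+ 2 >= 1]. *)
rewrite sumE; case: fw => fwE; rewrite fwE in sum_le *.
  have : 1 - Y <= 1 / 2 by nra.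
  by nra.
have : 1 - Y <= 1 / 4 by nra.
by nra.
Qed.

End OffVertex.
End LaplacianForm.

(** * Case analysis around a vertex [u] of maximal degree *)

Theorem theorem4p1 (R : rcfType) (G : sgraph) (n : nat)
    (order_G : #|G| = n) (n_gt2 : (2 < n)%N)
    (G_not_exceptional : forall r : nat,
       (r <= uphalf n - 2)%N \/ r = (n - 2)%N ->
       ~ isomorphic G (dunion (star (n - r - 1)) (edgeless r))) :
  (2 <= sigma R G)%N.
Proof.
rewrite -{n}order_G in n_gt2 G_not_exceptional.
have n_gt0 : (0 < #|G|)%N by apply: leq_trans n_gt2.
apply: sigma_ge2; first exact: ltnW.
have sum_d := sum_degree R n_gt0.
set t : R := _ / _ in sum_d *.
have [v0 _] := card_gt0P n_gt0.
have [u _ umax'] := arg_maxnP (fun v : G => degree v) (isT : xpredT v0).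
have umax (v : G) : (degree v <= degree u)%N by have := umax' v isT.
have nR : (0 : R) < #|G|%:R by rewrite ltr0n.
have tu : t <= (degree u)%:R.
  rewrite -(ler_pM2r nR) -sum_d [X in _ <= X]mulr_natr -sumr_const.
  by apply: ler_sum => v _; rewrite ler_nat.
have [/existsP[i /existsP[j /and3P[iu ju ij]]]|noedge] :=
  boolP [exists i, exists j, [&& i != u, j != u & adj i j]].
  have [Y1|Y1] := leP 1 ((degree u)%:R - t); last first.
    by apply: (mu2_near_regular sum_d n_gt2 iu ju ij); rewrite ?subr_ge0.
  have [k [l [ku lu kl heavy]]] := heavy_edge sum_d iu ju ij Y1.
  have Yi : 0 < ((degree u)%:R - t)^-1 by rewrite invr_gt0; lra.
  apply: (mu2_edge ku lu kl tu); first by lra.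
  apply: (@le_trans _ _ 1); first by case: adj; case: adj => /=; lra.
  by rewrite -ler_pdivrMl ?mulr1; lra.
have off_u (i j : G) : i != u -> j != u -> ~~ adj i j.
  move=> iu ju; apply: contra noedge => ij.
  by apply/existsP; exists i; apply/existsP; exists j; rewrite iu ju.
have degree_off (i : G) : i != u -> degree i = adj u i.
  move=> iu; rewrite degreeE (bigD1 u) //= big1 ?addn0 => [|j ju]; first by rewrite adj_sym.
  by rewrite (negPf (off_u _ _ iu ju)).
(* Every edge is a spoke at [u], so the degrees of the other vertices add up to [degree u] again. *)
have t_star : t * #|G|%:R = 2 * (degree u)%:R.
  rewrite -sum_d -natr_sum -natrM; congr (_%:R).
  rewrite (bigD1 u) //= mulSn mul1n; congr (_ + _)%N.
  rewrite [RHS]degreeE [RHS](bigD1 u) //= adj_irrefl add0n.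
  by apply: eq_bigr => i /degree_off.
have leaves_nonadj (i j : G) : i != u -> j != u -> i != j -> t <= (degree i)%:R ->
    t <= (degree j)%:R -> t <= mu R G 2.
  by move=> iu ju ij; apply: mu2_nonadjacent; rewrite ?off_u.
have [u0|u_gt0] := posnP (degree u).
  have t0 : t = 0.
    by apply: (mulIf (lt0r_neq0 nR)); rewrite t_star u0 mulr0 mul0r.
  have : (1 < #|~: [set u]|)%N by rewrite cardsC1; lia.
  case/card_gt1P => i [j [iu ju ij]]; rewrite !inE in iu ju.
  by apply: (leaves_nonadj i j); rewrite // t0 ler0n.
have := star_iso off_u.
set r := (_ - _ - _)%N => iso.
have du_lt := degree_lt u.
have du_eq : degree u = (#|G| - r - 1)%N by rewrite /r; lia.
rewrite {1}du_eq in iso.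
(* The first bound gives [degree u <= n / 2], hence [t <= 1], the degree of a leaf; the second
   excludes [degree u = 1], so there are two leaves. *)
have [r1 r2] : (uphalf #|G| - 2 < r)%N /\ r <> (#|G| - 2)%N.
  split; last by move=> r2; apply: (G_not_exceptional r) iso; right.
  by rewrite ltnNge; apply/negP => r1; apply: (G_not_exceptional r) iso; left.
have t1 : t <= 1.
  rewrite -(ler_pM2r nR) t_star mul1r -natrM ler_nat.
  by move: r1; rewrite /r uphalf_half; have := odd_double_half #|G|; lia.
have : (1 < degree u)%N by rewrite /r in r2; lia.
case/card_gt1P => i [j [ui uj ij]]; rewrite !inE in ui uj.
have iu : i != u by rewrite eq_sym adj_neq.
have ju : j != u by rewrite eq_sym adj_neq.
by apply: (leaves_nonadj i j); rewrite // degree_off // ?ui ?uj.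
Qed.
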